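(* Suppose two functions $\phi:E\to\mathbb R$ and $\psi:E\to\mathbb R$ constitute a solution to the characterizing equation. Then any vector $\hat{\mathbf q}=(\hat q_x)_{x\in E}$, where for each $x\in E$ the number $\hat q_x$ is the maximal element of the set of maximizers $q\in[0,1]$ of $$q f(x)+(1-q)\mathbb E_x(\phi(X_1))+g\big(q h(x)+(1-q)\mathbb E_x(\psi(X_1))\big),$$ is an equilibrium whose equilibrium value function is given by $J_{\hat{\mathbf q}}(x)=\phi(x)+g(\psi(x))$, $x\in E$.
   Context: Setting: $E$ is a finite set with $N$ elements and $X=(X_n)_{n\in\mathbb N_0}$ is a time-homogeneous (strong) Markov chain on $E$; under $\mathbb P_x$ (expectation $\mathbb E_x$) one has $X_0=x$ a.s. The chain is absorbing: from every $x\in E$ some absorbing state is reached with positive probability in finitely many steps. $(Y_n)_{n\in\mathbb N_0}$ is a process where each $Y_n$ is uniformly distributed on $[0,1]$ and independent of $X$ and of every $Y_k$, $k\ne n$. $f,h:E\to\mathbb R$ are functions and $g:\mathbb R\to\mathbb R$ is continuous. Vectors in $\mathbb R^N$ are identified with functions on $E$: $\mathbf p=(p_x)_{x\in E}$. A (mixed) stopping strategy is a vector $\mathbf p\in[0,1]^N$; its stopping time is $\tau_{\mathbf p}=\min\{n\ge0: Y_n\le p_{X_n}\}$ ($=\infty$ if there is no such $n$). Convention: on $\{\tau=\infty\}$, $f(X_\tau):=\lim_{n\to\infty}f(X_n)$ and $h(X_\tau):=\lim_{n\to\infty}h(X_n)$ (the limits exist because $X$ is absorbing). Notation: $\phi_{\mathbf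 p}(x)=\mathbb E_x(f(X_{\tau_{\mathbf p}}))$, $\psi_{\mathbf p}(x)=\mathbb E_x(h(X_{\tau_{\mathbf p}}))$, $J_{\mathbf p}(x)=\phi_{\mathbf p}(x)+g(\psi_{\mathbf p}(x))$. A stopping strategy $\hat{\mathbf p}$ is an equilibrium if for all $q\in[0,1]$ and all $x\in E$, $$J_{\hat{\mathbf p}}(x)\ge q f(x)+(1-q)\mathbb E_x(\phi_{\hat{\mathbf p}}(X_1))+g\big(q h(x)+(1-q)\mathbb E_x(\psi_{\hat{\mathbf p}}(X_1))\big);$$ then $J_{\hat{\mathbf p}}$ is called its equilibrium value function. Characterizing equation: functions $\phi,\psi:E\to\mathbb R$ are a solution to the characterizing equation if, for all $x\in E$, $$\phi(x)+g(\psi(x))=\max_{q\in[0,1]}\Big\{q f(x)+(1-q)\mathbb E_x(\phi(X_1))+g\big(q h(x)+(1-q)\mathbb E_x(\psi(X_1))\big)\Big\},$$ $$\phi(x)=\hat q_x f(x)+(1-\hat q_x)\mathbb E_x(\phi(X_1)),\qquad \psi(x)=\hat q_x h(x)+(1-\hat q_x)\mathbb E_x(\psi(X_1)),$$ where $\hat q_x$ is the maximal element of the set of maximizers $q\in[0,1]$ in the first equation.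
   Formalization: The formal theorem also assumes φ(y)=f(y) and ψ(y)=h(y) at every absorbing state y; without this the claim fails (single state, f=h=g=0, φ=1, ψ=0 gives q̂=0, J=0≠1), and it holds whenever the claimed value identity does. *)

(* Defs.v *)
From HB Require Import structures.
From mathcomp Require Import all_boot all_order all_algebra.
From mathcomp Require Import finmap.
From mathcomp Require Import all_classical all_reals all_analysis.

Set Implicit Arguments.
Unset Strict Implicit.
Unset Printing Implicit Defensive.

Import Order.TTheory GRing.Theory Num.Theory.
Import numFieldNormedType.Exports.

Local Open Scope classical_set_scope.
Local Open Scope ring_scope.

Definition greatest (R : realType) (S : set R) (m : R) : Prop :=
  S m /\ ubound S m.

Section Independence.
Context (d : measure_display) (T : measurableType d) (R : realType).

Definition mutually_independent (I : choiceType) (P : probability T R)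
    (F : I -> set (set T)) : Prop :=
  forall (J : {fset I}) (A : I -> set T), (forall i, i \in J -> F i (A i)) ->
    P (\bigcap_(i in [set` J]) A i) = (\prod_(i <- J) P (A i))%E.

End Independence.

Section Chain.
Context (d : measure_display) (Om : measurableType d) (R : realType).
Context (E : finType).

(* [Pr x] is the law under which the chain [X] starts at [x]. *)
Variables (Pr : E -> probability Om R) (X : nat -> Om -> E).

Definition path_event (n : nat) (e : nat -> E) : set Om :=
  [set w | forall k, (k <= n)%N -> X k w = e k].

(* The last clause is
     P_x(X_{n+1} = e_{n+1} | X_0 = e_0, .., X_n = e_n) = P_{e_n}(X_1 = e_{n+1}),
   multiplied out so that conditioning events of probability zero need no
   separate treatment.  As time is discrete and E is finite, the strong Markov
   property is a consequence. *)
Definition markov_chain : Prop :=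
  [/\ forall n e, measurable (X n @^-1` [set e]),
      forall x, Pr x (X 0%N @^-1` [set x]) = 1%E
    & forall x n e, Pr x (path_event n.+1 e) =
        (Pr x (path_event n e) * Pr (e n) (X 1%N @^-1` [set e n.+1]))%E].

Definition absorbing_state (y : E) : Prop :=
  Pr y (X 1%N @^-1` [set y]) = 1%E.

Definition absorbing_chain : Prop :=
  forall x, exists y n, absorbing_state y /\ (0 < Pr x (X n @^-1` [set y]))%E.

Definition sigma_X : set (set Om) :=
  <<s [set A | exists n e, A = X n @^-1` [set e]] >>.

Definition sigma_real (U : Om -> R) : set (set Om) :=
  [set A | exists2 B : set R, measurable B & A = U @^-1` B].

(* [None] stands for the whole process X, [Some n] for the variable Y_n. *)
Definition uniform_randomization (Y : nat -> Om -> R) : Prop :=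
  [/\ forall n, measurable_fun setT (Y n),
      forall x n (B : set R), measurable B ->
        Pr x (Y n @^-1` B) = uniform_prob (@ltr01 R) B
    & forall x, mutually_independent (Pr x)
        (fun i : option nat => if i is Some n then sigma_real (Y n)
                               else sigma_X)].

Definition strategy (p : E -> R) : Prop := forall x, p x \in `[0, 1].

Variable Y : nat -> Om -> R.

(* [None] is the value +oo. *)
Definition tau (p : E -> R) (w : Om) : option nat :=
  match pselect (exists n, Y n w <= p (X n w)) with
  | left H => Some (ex_minn H)
  | right _ => None
  end.

(* On {tau_p = +oo} the limit exists almost surely, because X is absorbing;
   where it does not exist, [limn] is a junk value on a null event. *)
Definition stopped (u : E -> R) (p : E -> R) (w : Om) : R :=
  if tau p w is Some n then u (X n w) else limn (fun n => u (X n w)).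

Definition stopped_mean (u : E -> R) (p : E -> R) (x : E) : R :=
  fine ('E_(Pr x)[stopped u p])%E.

Definition next_mean (u : E -> R) (x : E) : R :=
  fine ('E_(Pr x)[fun w => u (X 1%N w)])%E.

Variables (f h : E -> R) (g : R -> R).

Definition J (p : E -> R) (x : E) : R :=
  stopped_mean f p x + g (stopped_mean h p x).

Definition local_payoff (phi psi : E -> R) (x : E) (q : R) : R :=
  q * f x + (1 - q) * next_mean phi x
  + g (q * h x + (1 - q) * next_mean psi x).

Definition equilibrium (p : E -> R) : Prop :=
  strategy p /\
  forall q : R, q \in `[0, 1] -> forall x,
    local_payoff (stopped_mean f p) (stopped_mean h p) x q <= J p x.

Definition maximizers (phi psi : E -> R) (x : E) : set R :=
  [set q | q \in `[0, 1] /\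
     forall r, r \in `[0, 1] ->
       local_payoff phi psi x r <= local_payoff phi psi x q].

Definition characterizing_solution (phi psi : E -> R) : Prop :=
  forall x,
    greatest [set local_payoff phi psi x q | q in `[0, 1]]
             (phi x + g (psi x)) /\
    exists q, [/\ greatest (maximizers phi psi x) q,
                  phi x = q * f x + (1 - q) * next_mean phi x
                & psi x = q * h x + (1 - q) * next_mean psi x].

(* At an absorbing state every strategy has the payoffs f and h, whereas the
   equation there only says phi = q f + (1 - q) phi, and likewise for psi, which
   is void for q = 0.  For instance with a single state, f = h = g = 0, phi = 1
   and psi = 0, the equation holds with maximal maximizer 0, but J = 0.  Under
   this condition the maximal maximizer at an absorbing state is 1. *)
Definition absorbing_boundary (phi psi : E -> R) : Prop :=
  forall y, absorbing_state y -> phi y = f y /\ psi y = h y.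

End Chain.

(* Main.v *)
(** Writing [v] for [phi] (resp. [psi]) and [u] for [f] (resp. [h]), the
    recursion [v = qhat * u + (1 - qhat) * E(v(X_1))] says that the process equal
    to [u(X_tau)] once stopped and to [v(X_n)] before is a bounded martingale
    started at [v(x)].  As [X] is absorbed almost surely and [v = u] at absorbing
    states, it converges almost surely to [u(X_tau)], so by dominated convergence
    [E_x(u(X_tau)) = v(x)].  The value functions of [qhat] are therefore [phi]
    and [psi], and the equilibrium inequality is the first line of the
    characterizing equation. *)

Require Import Defs.
From HB Require Import structures.
From mathcomp Require Import all_boot all_order all_algebra.
From mathcomp Require Import finmap ring.
From mathcomp Require Import all_classical all_reals all_analysis.
From mathcomp Require Import measurable_realfun.

Import numFieldNormedType.Exports.
Import Order.TTheory GRing.Theory Num.Theory.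

(** * Random variables with values in a finite type *)

Section FiniteValued.
Set Implicit Arguments.
Unset Strict Implicit.
Local Open Scope classical_set_scope.
Local Open Scope ring_scope.
Context (d : measure_display) (Om : measurableType d) (R : realType).
Context (P : probability Om R).

Lemma fine_probK (A : set Om) : measurable A -> (fine (P A))%:E = P A.
Proof. by move=> mA; rewrite fineK// fin_num_measure. Qed.

Lemma fine_probS (A B : set Om) : measurable A -> measurable B ->
  A `<=` B -> fine (P A) <= fine (P B).
Proof.
by move=> mA mB AB; rewrite fine_le ?fin_num_measure// le_measure ?inE.
Qed.

Context (T : finType) (W : Om -> T).
Hypothesis mW : forall t, measurable (W @^-1` [set t]).

Lemma measurable_preimage_fin (A : set T) : measurable (W @^-1` A).
Proof.
have -> : W @^-1` A = \bigcup_(t in A) (W @^-1` [set t]).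
  apply/seteqP; split => w /=; first by move=> Aw; exists (W w).
  by move=> [t At /= ->].
by apply: fin_bigcup_measurable => //; exact: finite_finset.
Qed.

Lemma measurable_comp_fin (v : T -> R) : measurable_fun setT (v \o W).
Proof.
by move=> _ B _; rewrite setTI comp_preimage; exact: measurable_preimage_fin.
Qed.

Lemma prob_partition (A : set Om) : measurable A ->
  fine (P A) = \sum_t fine (P (A `&` W @^-1` [set t])).
Proof.
move=> mA; apply: EFin_inj; rewrite -sumEFin fine_probK//.
rewrite (eq_bigr (fun t => P (A `&` W @^-1` [set t]))); last first.
  by move=> t _; rewrite fine_probK//; exact: measurableI.
rewrite -big_enum/= fsbig_seq; last exact: enum_uniq.
rewrite -measure_fin_bigcup//=; first last.
- by move=> i _; exact: measurableI.
- by move=> i j _ _ [w [[_ /= <-] [_ /= <-]]].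
- congr (P _); apply/seteqP; split => w /=; last by move=> [t _ []].
  by move=> Aw; exists (W w) => //=; rewrite mem_enum.
Qed.

Lemma expectation_fin (v : T -> R) :
  ('E_P[v \o W])%E = (\sum_t v t * fine (P (W @^-1` [set t])))%:E.
Proof.
have vE w : ((v \o W) w)%:E = (\sum_t (v t)%:E * (\1_(W @^-1` [set t]) w)%:E)%E.
  rewrite (bigD1 (W w))//= indicE mem_set//= mule1 big1 ?adde0// => t tW.
  by rewrite indicE memNset ?mule0//= => /esym/eqP; rewrite (negbTE tW).
rewrite unlock; under eq_integral do rewrite vE.
rewrite integral_sum//; last first.
  by move=> t; apply: integrableZl => //; exact: integrable_indic.
rewrite -sumEFin; apply: eq_bigr => t _.
rewrite integralZl//; last exact: integrable_indic.
by rewrite integral_indic// setIT EFinM fine_probK.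
Qed.

End FiniteValued.

(** * Half-lines under the uniform law on [0,1] *)

Section UniformProb.
Set Implicit Arguments.
Unset Strict Implicit.
Local Open Scope classical_set_scope.
Local Open Scope ring_scope.
Context (R : realType).

Lemma uniform_prob_le (q : R) : q \in `[0, 1] ->
  uniform_prob (@ltr01 R) `]-oo, q] = q%:E.
Proof.
rewrite in_itv/= => /andP[q0 q1]; rewrite /uniform_prob integral_uniform_pdf.
have -> : `]-oo, q] `&` `[0, 1] = [set` `[0, q]] :> set R.
  apply/seteqP; split => x /=; rewrite !in_itv/=.
    by move=> [-> /andP[-> _]].
  by move=> /andP[-> xq]; split => //; rewrite (le_trans xq).
rewrite (eq_integral (cst 1%E)); last first.
  move=> x; rewrite inE/= in_itv/= /uniform_pdf => /andP[-> xq].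
  by rewrite (le_trans xq q1)/= subr0 invr1.
by rewrite integral_cst//= mul1e lebesgue_measure_itv/= lte_fin;
  case: ltgtP q0 => // [_|<-] _; rewrite ?oppr0 ?adde0.
Qed.

Lemma uniform_prob_gt (q : R) : q \in `[0, 1] ->
  uniform_prob (@ltr01 R) `]q, +oo[ = (1 - q)%:E.
Proof.
move=> q01; rewrite -setCitvl.
by rewrite [LHS](@probability_setC _ _ _ (uniform_prob (@ltr01 R)))//
  [X in (_ - X)%E](uniform_prob_le q01).
Qed.

End UniformProb.

(** * Joint law of the chain and the randomization *)

Section Randomization.
Set Implicit Arguments.
Unset Strict Implicit.
Local Open Scope classical_set_scope.
Local Open Scope ring_scope.
Context (d : measure_display) (Om : measurableType d) (R : realType).
Context (E : finType) (Pr : E -> probability Om R).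
Context (X : nat -> Om -> E) (Y : nat -> Om -> R).
Hypothesis uniY : uniform_randomization Pr X Y.

(** Mutual independence is applied to the chain event at index [None] and to [Y k] at index [Some k]
    for [k < n]; the uniform laws are then inserted. *)
Lemma randomization_product x n (S : set Om) (B : nat -> set R) :
  sigma_X X S -> measurable S -> (forall k, measurable (B k)) ->
  fine (Pr x (S `&` \bigcap_(k in `I_n) (Y k @^-1` B k))) =
  fine (Pr x S) * \prod_(k < n) fine (uniform_prob (@ltr01 R) (B k)).
Proof.
case: uniY => mY lawY indY sS mS mB.
pose A (i : option nat) := if i is Some k then Y k @^-1` B k else S.
pose s : seq (option nat) := None :: map Some (iota 0 n).
have us : uniq s.
  rewrite /= map_inj_uniq ?iota_uniq ?andbT; last by move=> i j [].
  by apply/mapP => -[].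
(* Independence is stated over a finite set of indices; the permutation lets its product be computed
   along the list [s]. *)
have [J JE sE] : exists2 J : {fset option nat}, J =i s & perm_eq J s.
  exists (seq_fset tt s); first exact: seq_fsetE.
  by rewrite (perm_trans (seq_fset_perm _ _))// undup_id.
have AF i : i \in J ->
    (if i is Some k then sigma_real (Y k) else sigma_X X) (A i).
  by case: i => [k|] _ //=; exists (B k).
have := indY x (J) A AF.
rewrite (perm_big _ sE)/= big_cons big_map => AE.
transitivity (fine (Pr x (\bigcap_(i in [set` J]) A i))).
  congr (fine (Pr x _)); apply/seteqP; split => w /=.
    move=> [Sw Bw] [k|] //=; rewrite JE inE/= => /mapP[k' + [->]].
    by rewrite mem_iota => /Bw.
  move=> Aw; split; first by apply: (Aw None); rewrite /= JE inE.
  move=> k /= kn; apply: (Aw (Some k)).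
  by rewrite /= JE inE/=; apply/mapP; exists k; rewrite ?mem_iota.
have YB k : Pr x (Y k @^-1` B k) = (fine (uniform_prob (@ltr01 R) (B k)))%:E.
  rewrite -(lawY x k)// fine_probK// -[X in measurable X]setTI.
  by apply: mY => //; exact: mB.
rewrite AE -(fine_probK _ mS) (eq_bigr _ (fun k _ => YB k)) prodEFin/=.
by rewrite -(big_mkord xpredT (fun k => fine (uniform_prob _ (B k))))
  /index_iota subn0.
Qed.

Lemma path_event_sigma n e : sigma_X X (path_event X n e).
Proof.
have -> : path_event X n e = \bigcap_(k in `I_n.+1) (X k @^-1` [set e k]).
  by apply/seteqP; split => w /= XE k; exact: XE.
(* The intersection is formed in the measurable type generated by the chain, whose measurable sets
   are those of [sigma_X]. *)
apply: (@bigcap_measurableType _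
  (g_sigma_algebraType [set A | exists n e, A = X n @^-1` [set e]])) => k _.
by apply: sub_gen_smallest; exists k, (e k).
Qed.

End Randomization.

(** * The chain: initial law and transition probabilities *)

Section StoppedChain.
Set Implicit Arguments.
Unset Strict Implicit.
Local Open Scope classical_set_scope.
Local Open Scope ring_scope.

Lemma sum1_concentrated (R : realDomainType) (T : finType) (f : T -> R) i j :
  (forall k, 0 <= f k) -> \sum_k f k = 1 -> f i = 1 -> i != j -> f j = 0.
Proof.
move=> f0 f1 fi ij; apply/eqP; rewrite eq_le f0 andbT.
have : \sum_(k | k != i) f k = 0.
  by move: f1; rewrite (bigD1 i)//= fi -[RHS]addr0 => /addrI.
rewrite (bigD1 j) 1?eq_sym//= => <-.
by rewrite lerDl sumr_ge0.
Qed.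

Context (d : measure_display) (Om : measurableType d) (R : realType).
Context (E : finType) (Pr : E -> probability Om R).
Context (X : nat -> Om -> E) (Y : nat -> Om -> R).
Hypothesis markovX : markov_chain Pr X.
Hypothesis uniY : uniform_randomization Pr X Y.

Let mX n e : measurable (X n @^-1` [set e]).
Proof. by case: markovX. Qed.

Let mY n : measurable_fun setT (Y n).
Proof. by case: uniY. Qed.

Let mYB n B : measurable B -> measurable (Y n @^-1` B).
Proof. by move=> mB; rewrite -[X in measurable X]setTI; exact: mY. Qed.

Definition trans (y z : E) : R := fine (Pr y (X 1 @^-1` [set z])).

Definition marginal n (x y : E) : R := fine (Pr x (X n @^-1` [set y])).

Lemma trans_ge0 y z : 0 <= trans y z.
Proof. exact: fine_ge0. Qed.

Lemma marginal_ge0 n x y : 0 <= marginal n x y.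
Proof. exact: fine_ge0. Qed.

Lemma sum_marginal n x : \sum_y marginal n x y = 1.
Proof.
rewrite -[RHS]/(fine 1%:E) -(@probability_setT _ _ _ (Pr x)).
rewrite (prob_partition _ (mX n))//.
by apply: eq_bigr => y _; rewrite setTI.
Qed.

Lemma sum_trans y : \sum_z trans y z = 1.
Proof. exact: sum_marginal. Qed.

Lemma next_meanE (u : E -> R) x :
  next_mean Pr X u x = \sum_y u y * trans x y.
Proof.
by rewrite /next_mean -[fun w => _]/(u \o X 1%N) expectation_fin.
Qed.

Lemma marginal0 x y : marginal 0 x y = (x == y)%:R.
Proof.
have X0 : marginal 0 x x = 1 by rewrite /marginal; case: markovX => _ ->.
have [<-//|xy] := eqVneq x y.
exact: (sum1_concentrated (marginal_ge0 0 x) (sum_marginal 0 x) X0).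
Qed.

Lemma measurable_path_event n e : measurable (path_event X n e).
Proof.
have -> : path_event X n e = \bigcap_(k in `I_n.+1) (X k @^-1` [set e k]).
  by apply/seteqP; split => w /= XE k; exact: XE.
by apply: bigcap_measurableType => k _; exact: mX.
Qed.

Lemma prob_path_eventS x n e : fine (Pr x (path_event X n.+1 e)) =
  fine (Pr x (path_event X n e)) * trans (e n) (e n.+1).
Proof.
case: markovX => _ _ ->; rewrite fineM ?fin_num_measure//.
exact: measurable_path_event.
Qed.

(** * One step of the chain while it has not been stopped *)

Section OneStep.
Variable B : E -> set R.
Hypothesis mB : forall y, measurable (B y).

(** [B y] collects the values of the randomization at which the process goes on from [y]. Half-lines
    give the stopping rule, the full line gives the chain alone. *)
Definition running n y : set Om :=
  [set w | X n w = y /\ forall k, (k < n)%N -> B (X k w) (Y k w)].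

(** A single variable of finite type, so that [prob_partition] applies to whole paths. *)
Definition history n w : {ffun 'I_n.+1 -> E} := [ffun i : 'I_n.+1 => X i w].

(** Extends a finite path to all times; [path_event X n] does not read the arbitrary values beyond
    [n]. *)
Definition path_of n (t : {ffun 'I_n.+1 -> E}) (k : nat) : E := t (inord k).

Lemma history_preimage n t :
  history n @^-1` [set t] = path_event X n (path_of t).
Proof.
apply/seteqP; split => w /=.
  by move=> <- k kn; rewrite /path_of ffunE inordK.
by move=> Xt; apply/ffunP => i; rewrite ffunE Xt ?leq_ord// /path_of inord_val.
Qed.

Lemma measurable_history n t : measurable (history n @^-1` [set t]).
Proof. by rewrite history_preimage; exact: measurable_path_event. Qed.

Lemma measurable_running n y : measurable (running n y).
Proof.
have -> : running n y = X n @^-1` [set y] `&`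
    \bigcap_(k in `I_n) \bigcup_(e in [set: E])
      (X k @^-1` [set e] `&` Y k @^-1` B e).
  apply/seteqP; split => w /= [Xy YB]; split => // k /= kn.
    by exists (X k w) => //; split => //; exact: YB.
  by have [e _ [/= -> ]] := YB k kn.
apply: measurableI => //; apply: bigcap_measurableType => k _.
apply: fin_bigcup_measurable; first exact: finite_finset.
by move=> e _; apply: measurableI => //; exact: mYB.
Qed.

(* Summing over the paths up to time [n] freezes the thresholds [B (X k w)], so
   that independence and the path form of the Markov property apply. *)
Lemma one_step x n y z (C : set R) : measurable C ->
  fine (Pr x (running n y `&` (X n.+1 @^-1` [set z] `&` Y n @^-1` C))) =
  fine (Pr x (running n y)) * trans y z * fine (uniform_prob (@ltr01 R) C).
Proof.
move=> mC; have mR := measurable_running n y; have mYC := mYB n mC.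
rewrite (prob_partition _ (measurable_history (n := n))); last first.
  by apply: measurableI => //; exact: measurableI.
rewrite (prob_partition _ (measurable_history (n := n)) mR) !mulr_suml.
apply: eq_bigr => t _; rewrite !history_preimage; set e := path_of t.
(* A path that does not end in [y] contributes zero on both sides. *)
have [eny|eny] := eqVneq (e n) y; last first.
  have H : running n y `&` path_event X n e = set0.
    apply/seteqP; split => // w [[Xy _] Xe]; move: eny.
    by rewrite -Xy -Xe ?eqxx.
  by rewrite setIAC H set0I measure0 !mul0r.
pose e' k := if k == n.+1 then z else e k.
pose B' k := if k == n then C else B (e k).
have mB' k : measurable (B' k) by rewrite /B'; case: ifP.
have e'E k : (k <= n)%N -> e' k = e k.
  by move=> kn; rewrite /e'; case: eqP => // kn1; rewrite kn1 ltnn in kn.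
have pathE : path_event X n e' = path_event X n e.
  by apply/seteqP; split => w Xe k kn; rewrite Xe// e'E.
transitivity (fine (Pr x (path_event X n.+1 e' `&`
    \bigcap_(k in `I_n.+1) (Y k @^-1` B' k)))).
  congr (fine (Pr x _)); apply/seteqP; split => w.
    move=> [[[Xy YB] [Xz YC]] Xe]; split.
      move=> k; rewrite leq_eqVlt ltnS => /predU1P[->|kn].
        by rewrite /e' eqxx.
      by rewrite e'E// Xe.
    move=> k /=; rewrite ltnS /B' leq_eqVlt => /predU1P[->|kn].
      by rewrite eqxx.
    by rewrite ltn_eqF// -Xe 1?ltnW//; exact: YB.
  move=> [Xe' YB']; have Xe : path_event X n e w.
    by rewrite -pathE => k kn; apply: Xe'; exact: leqW.
  split => //; split.
    split; first by rewrite -eny; exact: Xe.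
    move=> k kn; have := YB' k (ltnW kn).
    by rewrite /= /B' ltn_eqF// Xe// ltnW.
  split; first by rewrite /= Xe'// /e' eqxx.
  by have := YB' n (ltnSn n); rewrite /= /B' eqxx.
rewrite (randomization_product uniY)//; first last.
- exact: measurable_path_event.
- exact: path_event_sigma.
have -> : fine (Pr x (path_event X n.+1 e')) =
    fine (Pr x (path_event X n e)) * trans y z.
  by rewrite prob_path_eventS pathE e'E// eny /e' eqxx.
rewrite big_ord_recr/= [in X in _ * (_ * fine X)]/B' eqxx.
rewrite !mulrA; congr (_ * _); rewrite mulrAC; congr (_ * _).
(* The same factorization, read backwards over the times before [n], restores the event
   [running]. *)
transitivity (fine (Pr x (path_event X n e `&`
    \bigcap_(k in `I_n) (Y k @^-1` B' k)))).
  rewrite (randomization_product uniY)//.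
  - exact: path_event_sigma.
  - exact: measurable_path_event.
congr (fine (Pr x _)); apply/seteqP; split => w.
  move=> [Xe YB']; split => //; split; first by rewrite -eny; exact: Xe.
  by move=> k kn; have := YB' k kn; rewrite /= /B' ltn_eqF// Xe// ltnW.
move=> [[Xy YB] Xe]; split => // k kn.
by rewrite /= /B' ltn_eqF// -Xe 1?ltnW//; exact: YB.
Qed.

End OneStep.

(** * Chapman-Kolmogorov equations *)

Lemma joint_marginal x n y z :
  fine (Pr x (X n @^-1` [set y] `&` X n.+1 @^-1` [set z])) =
  marginal n x y * trans y z.
Proof.
(* Constraints that always hold turn [one_step] into a statement about the chain alone. *)
pose B (_ : E) := [set: R].
have RE : running B n y = X n @^-1` [set y].
  by apply/seteqP; split => w //= [].
have := @one_step B (fun=> measurableT) x n y z setT measurableT.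
rewrite RE preimage_setT setIT => ->.
by rewrite (@probability_setT _ _ _ (uniform_prob (@ltr01 R)))/= mulr1.
Qed.

Lemma marginalSr n x z :
  marginal n.+1 x z = \sum_y marginal n x y * trans y z.
Proof.
rewrite /marginal (prob_partition _ (mX n))//.
by apply: eq_bigr => y _; rewrite setIC joint_marginal.
Qed.

(** The Markov property splits off the last step; exchanging sums by induction splits off the first,
    as the recursion of [survival] in its starting state requires. *)
Lemma marginalSl n x z :
  marginal n.+1 x z = \sum_y trans x y * marginal n y z.
Proof.
elim: n z => [|n IHn] z.
  rewrite (bigD1 z)//= marginal0 eqxx mulr1 big1 ?addr0// => y yz.
  by rewrite marginal0 (negbTE yz) mulr0.
rewrite marginalSr; under eq_bigr do rewrite IHn mulr_suml.
rewrite exchange_big/=; apply: eq_bigr => y _.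
by rewrite marginalSr mulr_sumr; apply: eq_bigr => i _; rewrite mulrA.
Qed.

(** * Absorbing states and the probability of not being absorbed *)

Lemma absorbing_stateE y : absorbing_state Pr X y <-> trans y y = 1.
Proof.
rewrite /absorbing_state -(fine_probK (Pr y) (mX 1 y)).
by split => [[]|] //; rewrite /trans => ->.
Qed.

Lemma trans_absorbing y z : trans y y = 1 -> y != z -> trans y z = 0.
Proof.
by move=> yy; apply: (sum1_concentrated (trans_ge0 y) (sum_trans y) yy).
Qed.

Definition survival n x : R := \sum_(y | trans y y != 1) marginal n x y.

Lemma survival_ge0 n x : 0 <= survival n x.
Proof. by apply: sumr_ge0 => y _; exact: marginal_ge0. Qed.

Lemma survival_prob n x :
  survival n x = fine (Pr x (X n @^-1` [set y | trans y y != 1])).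
Proof.
rewrite (prob_partition _ (mX n)); last exact: (measurable_preimage_fin (mX n)).
rewrite /survival big_mkcond; apply: eq_bigr => y _; case: ifPn => yy.
  congr (fine (Pr x _)); apply/seteqP; split => w /=; last by move=> [].
  by move=> ->.
rewrite (_ : _ `&` _ = set0) ?measure0//; apply/seteqP; split => // w /= [].
by move=> + Xy; rewrite Xy (negbTE yy).
Qed.

(** An absorbing state sends no mass to the other states, and a non-absorbing one passes on at most
    the mass it has. *)
Lemma survivalS_le n x : survival n.+1 x <= survival n x.
Proof.
rewrite /survival; under eq_bigr do rewrite marginalSr.
rewrite exchange_big/= [leRHS]big_mkcond/=; apply: ler_sum => y _.
rewrite -mulr_sumr; case: ifPn => [_|/negPn/eqP yy].
  rewrite ler_piMr ?marginal_ge0// -[leRHS](sum_trans y).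
  rewrite [leRHS](bigID (fun z => trans z z != 1))/=.
  by rewrite lerDl sumr_ge0// => z _; exact: trans_ge0.
rewrite big1 ?mulr0// => z zz; apply: trans_absorbing => //.
by apply: contraNneq zz => <-; rewrite yy.
Qed.

Lemma survivalS n x : survival n.+1 x = \sum_y trans x y * survival n y.
Proof.
rewrite /survival; under eq_bigr do rewrite marginalSl.
by rewrite exchange_big/=; apply: eq_bigr => y _; rewrite mulr_sumr.
Qed.

Lemma survival_absorbing n y : trans y y = 1 -> survival n y = 0.
Proof.
move=> yy; apply/eqP; rewrite eq_le survival_ge0 andbT.
elim: n => [|n]; last exact: le_trans (survivalS_le n y).
rewrite /survival big1// => z zz; rewrite marginal0.
by have [yz|//] := eqVneq y z; move: zz; rewrite -yz yy eqxx.
Qed.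

Hypothesis absX : absorbing_chain Pr X.

Lemma survival_nonincreasing x :
  {homo survival ^~ x : m n / (m <= n)%N >-> n <= m}.
Proof. by apply/nonincreasing_seqP => n; exact: survivalS_le. Qed.

Lemma is_cvg_survival x : cvgn (survival ^~ x).
Proof.
apply: nonincreasing_is_cvgn; first exact: survival_nonincreasing.
by exists 0 => _ [n _ <-]; exact: survival_ge0.
Qed.

(* The limit is a harmonic function vanishing at absorbing states, so the
   maximum principle forces it to be zero. *)
Lemma cvg_survival x : survival ^~ x @ \oo --> (0 : R).
Proof.
pose s y : R := limn (survival ^~ y).
have s_ge0 y : 0 <= s y.
  apply: limr_ge; first exact: is_cvg_survival.
  by apply: nearW => n; exact: survival_ge0.
have s_harm y : s y = \sum_z trans y z * s z.
  have cv : (fun n => survival n.+1 y) @ \oo --> s y.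
    by rewrite (cvg_shiftS (survival ^~ y)); exact: is_cvg_survival.
  have cv' : (fun n => survival n.+1 y) @ \oo --> \sum_z trans y z * s z.
    rewrite (funext (fun n => survivalS n y)).
    apply: cvg_big => [|z _]; first exact: add_continuous.
    by apply: cvgMr; exact: is_cvg_survival.
  exact: (cvg_unique _ cv cv').
(* Harmonicity is iterated because an absorbing state may be reached only after several steps. *)
have s_marginal n y : s y = \sum_z marginal n y z * s z.
  elim: n y => [|n IHn] y.
    rewrite (bigD1 y)//= marginal0 eqxx mul1r big1 ?addr0// => z zy.
    by rewrite marginal0 eq_sym (negbTE zy) mul0r.
  rewrite s_harm; under eq_bigr do rewrite IHn mulr_sumr.
  rewrite exchange_big/=; apply: eq_bigr => z _.
  by rewrite marginalSl mulr_suml; apply: eq_bigr => i _; rewrite mulrA.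
have s_abs y : trans y y = 1 -> s y = 0.
  move=> yy; rewrite /s (_ : survival ^~ y = cst 0) ?lim_cst//.
  by apply/funext => n; rewrite survival_absorbing.
suff s0 : s x = 0 by rewrite -s0; exact: is_cvg_survival.
have [x0 _ x0max] := @arg_maxP _ _ _ x xpredT s isT.
have [y [n [/absorbing_stateE yabs ny]]] := absX x0.
have m_gt0 : 0 < marginal n x0 y.
  by rewrite -lte_fin fine_probK.
(* At the maximum [s x0], the mass sent to [y] contributes zero to the [n]-step mean and the rest at
   most [s x0] each; as that mass is positive, [s x0] cannot be. *)
have : s x0 <= s x0 * (1 - marginal n x0 y).
  rewrite {1}(s_marginal n) (bigD1 y)//= (s_abs y)// mulr0 add0r.
  rewrite -(sum_marginal n x0) [X in _ * (X - _)](bigD1 y)//=.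
  rewrite addrAC subrr add0r mulr_sumr; apply: ler_sum => z _.
  by rewrite mulrC ler_wpM2r ?marginal_ge0//; exact: x0max.
rewrite mulrBr mulr1 lerDl oppr_ge0 pmulr_lle0// => sx0.
by apply/eqP; rewrite eq_le s_ge0 andbT (le_trans _ sx0)//; exact: x0max.
Qed.

(** * Almost sure absorption *)

Lemma ae_absorbed x : \forall w \ae Pr x, exists n,
  absorbing_state Pr X (X n w) /\ forall m, (n <= m)%N -> X m w = X n w.
Proof.
(* First null event: an absorbing state is left. For a fixed time and state this has a transition
   probability zero as a factor, and there are countably many such pairs. *)
have stay : \forall w \ae Pr x, forall n,
    absorbing_state Pr X (X n w) -> X n.+1 w = X n w.
  apply: ae_foralln => n.
  have stay y : \forall w \ae Pr x, absorbing_state Pr X y -> X n w = y ->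
      X n.+1 w = y.
    have [yy|yy] := eqVneq (trans y y) 1; last first.
      by apply: aeW => w /absorbing_stateE /eqP; rewrite (negbTE yy).
    have mD : measurable (X n @^-1` [set y] `&` X n.+1 @^-1` [set~ y]).
      by apply: measurableI => //; exact: (measurable_preimage_fin (mX n.+1)).
    exists (X n @^-1` [set y] `&` X n.+1 @^-1` [set~ y]); split => //.
      rewrite -fine_probK//; congr EFin.
      rewrite (prob_partition _ (mX n.+1))// big1// => z _.
      have [->|yz] := eqVneq z y.
        rewrite (_ : _ `&` _ = set0) ?measure0//.
        by apply/seteqP; split => // w [[]].
      rewrite -setIA (_ : X n.+1 @^-1` _ `&` _ = X n.+1 @^-1` [set z]); last first.
        apply/seteqP; split => w /=; first by move=> [_].
        by move=> ->; split => //; exact/eqP.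
      by rewrite joint_marginal trans_absorbing ?mulr0 1?eq_sym.
    by move=> w /= /not_implyP[_ /not_implyP[]].
  have /filterS : \forall w \ae Pr x, forall y, absorbing_state Pr X y ->
      X n w = y -> X n.+1 w = y by exact: filter_forall.
  by apply=> w stw aw; exact: stw.
(* Second null event: no absorbing state is ever visited. Its probability is at most [survival n x]
   for every [n], hence zero in the limit. *)
have hit : \forall w \ae Pr x, exists n, absorbing_state Pr X (X n w).
  pose N n := X n @^-1` [set y | trans y y != 1].
  have mN n : measurable (N n) by exact: (measurable_preimage_fin (mX n)).
  have mI : measurable (\bigcap_n N n) by exact: bigcap_measurableType.
  exists (\bigcap_n N n); split => //.
    rewrite -fine_probK//; congr EFin; apply/eqP.
    rewrite eq_le fine_ge0// andbT.
    rewrite -(cvg_lim _ (cvg_survival x))//.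
    apply: limr_ge; first exact: is_cvg_survival.
    apply: nearW => n; rewrite survival_prob; apply: fine_probS => //.
      exact: mN.
    by move=> w Nw; exact: Nw.
  move=> w /= nex n _; apply/eqP => /absorbing_stateE aw.
  by apply: nex; exists n.
apply: filterS2 stay hit => w stw [n aw]; exists n; split => //.
elim=> [|m IHm]; first by rewrite leqn0 => /eqP ->.
rewrite leq_eqVlt => /predU1P[->//|]; rewrite ltnS => nm.
by rewrite stw IHm.
Qed.

(** * The chain stopped by a mixed strategy *)

Section Stopping.
Variable p : E -> R.
Hypothesis p01 : strategy p.

(* [inl y]: the process was stopped at [y] strictly before time [n];
   [inr y]: it is still running and [X n = y]. *)
Fixpoint status (n : nat) (w : Om) : E + E :=
  if n is m.+1 then
    match status m w with
    | inl y => inl y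
    | inr y => if Y m w <= p y then inl y else inr (X n w)
    end
  else inr (X 0%N w).

Let above y : set R := `]p y, +oo[.

Let mabove y : measurable (above y).
Proof. exact: measurable_itv. Qed.

Lemma status_inrP n w y : status n w = inr y <-> running above n y w.
Proof.
elim: n y => [|n IHn] y /=; first by split => [[<-]//|[->]].
case E1: (status n w) => [z|z].
  split => // -[_ YB]; suff: status n w = inr (X n w) by rewrite E1.
  by apply/IHn; split => // k kn; apply: YB; exact: leqW.
have /IHn[Xz YB] := E1; case: ifPn => Yz; split => //.
- move=> [_ YB']; have := YB' n (ltnSn n).
  by rewrite /above /= in_itv/= andbT Xz ltNge Yz.
- move=> [<-]; split => // k; rewrite ltnS leq_eqVlt.
  case/predU1P => [->|]; last exact: YB.
  by rewrite /above /= in_itv/= andbT Xz ltNge.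
- by move=> [<-].
Qed.

Lemma status_running n w : (forall k, (k < n)%N -> p (X k w) < Y k w) ->
  status n w = inr (X n w).
Proof.
move=> pY; apply/status_inrP; split => // k /pY.
by rewrite /above/= in_itv/= andbT.
Qed.

(** The comparison made at time [m] enters the status at time [m + 1], hence the strict
    inequality. *)
Lemma status_stopped m w : (forall k, (k < m)%N -> p (X k w) < Y k w) ->
  Y m w <= p (X m w) -> forall n, (m < n)%N -> status n w = inl (X m w).
Proof.
move=> pY Yp; elim=> // n IHn; rewrite ltnS leq_eqVlt => /predU1P[<-|mn] /=.
  by rewrite status_running// Yp.
by rewrite IHn.
Qed.

Lemma status_tau_None w : tau X Y p w = None ->
  forall n, status n w = inr (X n w).
Proof.
rewrite /tau; case: pselect => // H _ n; apply: status_running => k _.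
by rewrite ltNge; apply/negP => Yk; apply: H; exists k.
Qed.

Lemma status_tau_Some w m : tau X Y p w = Some m ->
  forall n, (m < n)%N -> status n w = inl (X m w).
Proof.
rewrite /tau; case: pselect => // H [<-]; case: ex_minnP => k Yk kmin.
apply: status_stopped => // i ik; rewrite ltNge; apply/negP => /kmin.
by rewrite leqNgt ik.
Qed.

Lemma status_inr_preimage n y :
  status n @^-1` [set inr y] = running above n y.
Proof. by apply/seteqP; split => w /status_inrP. Qed.

Lemma status0_inl_preimage y : status 0 @^-1` [set inl y] = set0.
Proof. by apply/seteqP; split. Qed.

Lemma statusS_inl_preimage n y : status n.+1 @^-1` [set inl y] =
  status n @^-1` [set inl y] `|` (running above n y `&` Y n @^-1` `]-oo, p y]).
Proof.
apply/seteqP; split => w /=.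
  case E1: (status n w) => [z|z]; first by move=> ->; left.
  case: ifPn => // Yz [zy]; right; split; last by rewrite in_itv/= -zy.
  by apply/status_inrP; rewrite E1 zy.
case=> [->//|[/status_inrP ->]]; rewrite in_itv/= => -> //.
Qed.

Lemma measurable_status n t : measurable (status n @^-1` [set t]).
Proof.
case: t => y; last by rewrite status_inr_preimage; exact: measurable_running.
elim: n => [|n IHn]; first by rewrite status0_inl_preimage.
rewrite statusS_inl_preimage; apply: measurableU => //.
by apply: measurableI; [exact: measurable_running|exact: mYB].
Qed.

(** * Transition law of the stopped process *)

Let run n x y : R := fine (Pr x (running above n y)).

(** [one_step] prescribes the next state; summing over it removes the transition factor and leaves
    the uniform probability [p y]. *)
Lemma prob_stop_now n x y :
  fine (Pr x (running above n y `&` Y n @^-1` `]-oo, p y])) = run n x y * p y.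
Proof.
have mYp : measurable (Y n @^-1` `]-oo, p y]) by exact: mYB.
rewrite (prob_partition _ (mX n.+1)); last first.
  by apply: measurableI => //; exact: measurable_running.
under eq_bigr do rewrite -setIA [X in _ `&` X]setIC one_step// uniform_prob_le//.
by rewrite -mulr_suml -mulr_sumr sum_trans mulr1.
Qed.

Lemma prob_runningS n x z : run n.+1 x z =
  \sum_y run n x y * (1 - p y) * trans y z.
Proof.
rewrite /run (prob_partition _ (mX n)); last exact: measurable_running.
apply: eq_bigr => y _; rewrite mulrAC.
rewrite -[1 - p y]/(fine (1 - p y)%:E) -(uniform_prob_gt (p01 y)) -one_step//.
congr (fine (Pr x _)); apply/seteqP; split => w /=.
  move=> [[Xz YB] Xy]; split; first by split => // k kn; exact: YB (leqW kn).
  by split => //; rewrite -/(above y) -Xy; exact: YB (ltnSn n).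
move=> [[Xy YB] [Xz Yn]]; split => //; split => // k.
by rewrite ltnS leq_eqVlt => /predU1P[->|]; [rewrite Xy|exact: YB].
Qed.

(** * The martingale of continuation values *)

Variables (u v : E -> R).
Hypothesis vE : forall x, v x = p x * u x + (1 - p x) * next_mean Pr X v x.

Definition status_value (t : E + E) : R :=
  match t with inl y => u y | inr y => v y end.

(** In one step the mass running at [y] either stops, earning [u y], or moves on, earning the mean
    of [v]; by [vE] the two parts add up to [v y], so the mean keeps its initial value. *)
Lemma status_mean n x : ('E_(Pr x)[status_value \o status n] = (v x)%:E)%E.
Proof.
rewrite (expectation_fin _ (measurable_status n)); congr EFin.
rewrite big_sumType/=; under [X in _ + X]eq_bigr do rewrite status_inr_preimage.
elim: n => [|n IHn].
  rewrite big1 ?add0r; last first.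
    by move=> y _; rewrite status0_inl_preimage measure0 mulr0.
  have runE y : fine (Pr x (running above 0 y)) = (x == y)%:R.
    rewrite -marginal0; congr (fine (Pr x _)).
    by apply/seteqP; split => w //= [].
  under eq_bigr do rewrite runE.
  rewrite (bigD1 x)//= eqxx mulr1 big1 ?addr0// => y yx.
  by rewrite eq_sym (negbTE yx) mulr0.
rewrite -[RHS]IHn.
have stopE y : u y * fine (Pr x (status n.+1 @^-1` [set inl y])) =
    u y * fine (Pr x (status n @^-1` [set inl y])) + u y * (run n x y * p y).
  rewrite -mulrDr; congr (_ * _).
  rewrite statusS_inl_preimage measureU; first last.
  - by apply/seteqP; split => // w [/= E1 [/status_inrP]]; rewrite E1.
  - by apply: measurableI; [exact: measurable_running|exact: mYB].
  - exact: measurable_status.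
  rewrite fineD ?fin_num_measure ?prob_stop_now//.
  - exact: measurable_status.
  - by apply: measurableI; [exact: measurable_running|exact: mYB].
under eq_bigr do rewrite stopE.
rewrite big_split/= -addrA; congr (_ + _).
under [X in _ + X]eq_bigr do rewrite -/(run _ _ _) prob_runningS mulr_sumr.
rewrite [X in _ + X]exchange_big/= -big_split/=; apply: eq_bigr => y _.
rewrite -/(run _ _ _) [v y]vE next_meanE mulrDl mulr_sumr mulr_suml.
congr (_ + _).
  by ring.
by apply: eq_bigr => z _; ring.
Qed.

(** * Measurability of the stopped payoff *)

Lemma cvgn_fin_valued (x : nat -> E) : cvgn (u \o x) ->
  exists m, forall n, u (x (m + n)%N) = u (x m).
Proof.
move=> cx; set l := limn (u \o x).
(* The values other than the limit form a finite, hence closed, set, so some neighbourhood of the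
   limit avoids them. *)
have cl : closed (range u `\ l).
  apply: (accessible_finite_set_closed.1 (hausdorff_accessible (@Rhausdorff R))).
  by apply: finite_setD; apply: finite_image; exact: finite_finset.
have /cx [N _ Nl] : nbhs l (~` (range u `\ l)).
  apply: open_nbhs_nbhs; split; first exact: closed_openC.
  by move=> [_ /(_ erefl)].
have xl n : (N <= n)%N -> u (x n) = l.
  by move=> /Nl/= nl; apply: contra_notP nl => xnl; split => //; exists (x n).
by exists N => n; rewrite !xl// leq_addr.
Qed.

(** Convergence here means being eventually constant, a countable combination of events at pairs of
    times. *)
Lemma measurable_cvgn : measurable [set w | cvgn (fun n => u (X n w))].
Proof.
have -> : [set w | cvgn (fun n => u (X n w))] = \bigcup_m \bigcap_n
    \bigcup_(e in [set e : E * E | u e.1 = u e.2])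
      (X (m + n)%N @^-1` [set e.1] `&` X m @^-1` [set e.2]).
  apply/seteqP; split => w /=.
    move=> /(cvgn_fin_valued (x := X ^~ w))[m mu]; exists m => // n _.
    by exists (X (m + n)%N w, X m w) => //=; exact: mu.
  move=> [m _ mu]; apply: (@is_cvg_near_cst _ _ (u (X m w))).
  exists m => // n /= mn; have [e /= eu [/= X1 X2]] := mu (n - m)%N I.
  by rewrite -(subnKC mn) X1 X2.
apply: bigcup_measurable => m _; apply: bigcap_measurableType => n _.
apply: fin_bigcup_measurable; first exact: finite_finset.
by move=> e _; exact: measurableI.
Qed.

Lemma measurable_stopped : measurable_fun setT (stopped X Y u p).
Proof.
pose C := [set w | cvgn (fun n => u (X n w))].
(* Measurable approximations converging at every point: off [C], a process still running gets
   [point], the value of [limn] on divergent sequences. *)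
pose frozen n w := if w \in C
  then ((fun t => match t with inl y | inr y => u y end) \o status n) w
  else ((fun t => if t is inl y then u y else point) \o status n) w.
apply: (@measurable_fun_cvg _ _ _ _ frozen) => [n|w _].
  apply: measurable_fun_ifT.
  - apply: (measurable_fun_bool true); rewrite setTI.
    rewrite (_ : _ @^-1` _ = C); first exact: measurable_cvgn.
    by apply/seteqP; split => w; [exact: set_mem|exact: mem_set].
  - exact/measurable_comp_fin/measurable_status.
  - exact/measurable_comp_fin/measurable_status.
rewrite /stopped; case E1: (tau X Y p w) => [m|].
  apply: cvg_near_cst; exists m.+1 => // n /= mn.
  by rewrite /frozen/= (status_tau_Some E1 mn)//; case: ifP.
have fE n : frozen n w = if w \in C then u (X n w) else point.
  by rewrite /frozen/= (status_tau_None E1).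
rewrite (funext fE).
case: (boolP (w \in C)) => Cw; first exact: (set_mem Cw).
rewrite dvgP; last by move: Cw; rewrite notin_setE.
exact: cvg_cst.
Qed.

(** * Passage to the limit in the martingale *)

Hypothesis v_abs : forall y, absorbing_state Pr X y -> v y = u y.

Lemma stopped_mean_value x : stopped_mean Pr X Y u p x = v x.
Proof.
pose M : R := \sum_y (`|u y| + `|v y|).
have valM t : `|status_value t| <= M.
  have leM y : `|u y| + `|v y| <= M.
    by rewrite /M (bigD1 y)//= lerDl sumr_ge0// => z _; rewrite addr_ge0.
  by case: t => y /=; apply: le_trans (leM y); rewrite ?lerDl ?lerDr.
have mf n : measurable_fun setT (fun w => (status_value (status n w))%:E).
  exact/measurable_EFinP/measurable_comp_fin/measurable_status.
have ms : measurable_fun setT (fun w => (stopped X Y u p w)%:E).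
  exact/measurable_EFinP/measurable_stopped.
(* After a stop the status is constant; without one, the chain ends in an absorbing state, where
   [v_abs] turns [v] into [u]. *)
have lim_status : \forall w \ae Pr x, setT w ->
    (status_value (status n w))%:E @[n --> \oo] --> (stopped X Y u p w)%:E.
  apply: filterS (ae_absorbed x) => w [n0 [aw Xw]] _.
  apply: cvg_EFin; first by apply: nearW.
  rewrite /stopped; case E1: (tau X Y p w) => [m|].
    apply: cvg_near_cst; exists m.+1 => // n /= mn.
    by rewrite (status_tau_Some E1 mn).
  rewrite (_ : limn _ = u (X n0 w)); last first.
    apply/cvg_lim => //; apply: cvg_near_cst; exists n0 => // n /= /Xw ->//.
  apply: cvg_near_cst; exists n0 => // n /= nn0.
  by rewrite (status_tau_None E1)/= Xw// v_abs.
have iM : (Pr x).-integrable setT (cst M%:E).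
  by apply: finite_measure_integrable_cst.
have [|_ _] := dominated_convergence measurableT mf ms lim_status iM.
  by apply: aeW => w n _; rewrite lee_fin valM.
rewrite (_ : (fun n => _) = cst (v x)%:E); last first.
  by apply/funext => n; rewrite -(status_mean n) unlock.
move=> /(cvg_lim (@ereal_hausdorff R)); rewrite lim_cst//.
by rewrite /stopped_mean unlock => <-.
Qed.

End Stopping.

End StoppedChain.

(** * The maximal maximizers form an equilibrium *)

Theorem theorem3p3 (R : realType) (E : finType)
    (d : measure_display) (Om : measurableType d)
    (Pr : E -> probability Om R) (X : nat -> Om -> E) (Y : nat -> Om -> R)
    (f h : E -> R) (g : R -> R) (phi psi qhat : E -> R) :
  markov_chain Pr X ->
  absorbing_chain Pr X ->
  uniform_randomization Pr X Y ->
  continuous g ->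
  characterizing_solution Pr X f h g phi psi ->
  absorbing_boundary Pr X f h phi psi ->
  (forall x, greatest (maximizers Pr X f h g phi psi x) (qhat x)) ->
  equilibrium Pr X Y f h g qhat /\
  (forall x, J Pr X Y f h g qhat x = (phi x + g (psi x))%R).
Proof.
move=> markovX absX uniY _ sol bnd qmax.
have q01 : strategy qhat by move=> x; case: (qmax x) => -[].
have solq x : (phi x = qhat x * f x + (1 - qhat x) * next_mean Pr X phi x /\
    psi x = qhat x * h x + (1 - qhat x) * next_mean Pr X psi x)%R.
  have [_ [q [[qM qub] phiE psiE]]] := sol x.
  have [qxM qxub] := qmax x.
  (* A greatest element is unique, so the maximizer in the equation is [qhat x]. *)
  suff -> : qhat x = q by [].
  by apply/eqP; rewrite eq_le qub// qxub.
have phiE x : stopped_mean Pr X Y f qhat x = phi x.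
  apply: stopped_mean_value => // [y|y /bnd[]//].
  by have [] := solq y.
have psiE x : stopped_mean Pr X Y h qhat x = psi x.
  apply: stopped_mean_value => // [y|y /bnd[]//].
  by have [] := solq y.
have JE x : J Pr X Y f h g qhat x = (phi x + g (psi x))%R.
  by rewrite /J phiE psiE.
split => //; split => // q q01' x.
rewrite JE (funext phiE) (funext psiE).
by have [[_ ub] _] := sol x; apply: ub; exists q.
Qed.
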